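(* Let assumptions A1, A2, A3 (stated in the context) hold, let $x^\star$ be as in A3, and let $\theta_k \in (0,2)$ for all $k$. Then the sequence $(x_k^\delta)$ generated by the PLWK iteration described in the context is well defined and $$x_k^\delta \in B_{\rho/2}(x^\star) \subset B_\rho(x_0), \qquad k = 0,\dots,k_*^\delta,$$ where $k_*^\delta$ is the stopping index defined in the context. Moreover, if $\theta_k \in [a,b] \subset (0,2)$ for all $k \le k_*^\delta$, then $k_*^\delta = O(\delta_{\min}^{-2})$, where $\delta_{\min} := \min\{\delta_0,\dots,\delta_{N-1}\}$ (this concerns the noisy data case $\delta_{\min}>0$). Additionally, in the particular case of exact data ($\delta_0 = \dots = \delta_{N-1} = 0$, $y_i^\delta = y_i$), the sequence $(x_k)$ defined by the PLWK iteration is well defined, $x_k \in B_{\rho/2}(x^\star) \subset B_\rho(x_0)$ for all $k \in \mathbb{N}$, $$\sum_{k=0}^\infty \lambda_k \|F_{[k]}(x_k) - y_{[k]}\|^2 < \infty \qquad\text{and}\qquad \sum_{k=0}^\infty \|x_{k+1} - x_k\|^2 < \infty .$$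
   Context: $X$ and $Y$ are Hilbert spaces, $N \ge 1$ is an integer, and $F_i : D(F_i) \subset X \to Y$, $i = 0,\dots,N-1$, are (in general nonlinear) operators. $B_r(x)$ denotes the ball of radius $r$ centred at $x$ in $X$. Exact data $y_0,\dots,y_{N-1} \in Y$, noisy data $y_0^\delta,\dots,y_{N-1}^\delta \in Y$ and noise levels $\delta_0,\dots,\delta_{N-1}$ satisfy $\|y_i^\delta - y_i\| \le \delta_i$ for all $i$. Assumption A1: each $F_i$ is continuous on $D(F_i)$; $D := \bigcap_{i} D(F_i)$ has nonempty interior; the initial iterate $x_0$ lies in $D$, and there exist constants $C, \rho > 0$ such that the Gateaux derivative $F_i'$ of $F_i$ is defined on $B_\rho(x_0) \subset D$ and $\|F_i'(x)\| \le C$ for all $x \in B_\rho(x_0)$ and $i = 0,\dots,N-1$. Assumption A2 (local tangential cone condition): for some $\eta < 1$, $\|F_i(\bar x) - F_i(x) - F_i'(x)(\bar x - x)\| \le \eta\, \|F_i(\bar x) - F_i(x)\|$ for all $x, \bar x \in B_\rho(x_0)$ and $i = 0,\dots,N-1$. Assumption A3: there exists $x^\star \in B_{\rho/2}(x_0)$ with $F_i(x^\star) = y_i$ for $i = 0,\dots,N-1$. PLWK (projective Landweber-Kaczmarz) iteration: write $[k] := k \bmod N \in \{0,\dots,N-1\}$. Fix $\tau > 1$ with $\tau > (1+\eta)(1-\eta)^{-1}$, and set $p_i(t) := t\big((1-\eta)t - (1+\eta)\delta_i\big)$. Starting from $x_0^\delta = x_0$, $$x_{k+1}^\delta := x_k^\delta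 - \theta_k \lambda_k \omega_k F_{[k]}'(x_k^\delta)^*\big(F_{[k]}(x_k^\delta) - y_{[k]}^\delta\big),$$ where $\theta_k$ is a relaxation parameter, $\omega_k := 1$ if $\|F_{[k]}(x_k^\delta) - y_{[k]}^\delta\| > \tau\delta_{[k]}$ and $\omega_k := 0$ otherwise, and $$\lambda_k := \frac{p_{[k]}\big(\|F_{[k]}(x_k^\delta) - y_{[k]}^\delta\|\big)}{\big\|F_{[k]}'(x_k^\delta)^*\big(F_{[k]}(x_k^\delta) - y_{[k]}^\delta\big)\big\|^2}$$ if $F_{[k]}'(x_k^\delta)^*(F_{[k]}(x_k^\delta) - y_{[k]}^\delta) \ne 0$, and $\lambda_k := 0$ otherwise. Here $F_i'(x)^*$ is the Hilbert space adjoint. For exact data the superscript $\delta$ is dropped. Stopping index: $k_*^\delta := \min\{ lN \in \mathbb{N} : x_{lN}^\delta = x_{lN+1}^\delta = \dots = x_{lN+N}^\delta \}$.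
   Formalization: For exact data, the convergence of the two series is stated under the additional assumption that θ_k ∈ [a,b] ⊂ (0,2) for all k up to the stopping index; under θ_k ∈ (0,2) alone both can diverge (e.g. F = id on ℝ, with θ_k tending quickly to 0 or to 2). *)

(* Defs.v *)
From HB Require Import structures.
From mathcomp Require Import all_boot all_order all_algebra.
From mathcomp Require Import all_classical all_reals all_analysis.

Set Implicit Arguments.
Unset Strict Implicit.
Unset Printing Implicit Defensive.

Import Order.TTheory GRing.Theory Num.Theory.
Import numFieldNormedType.Exports.

Local Open Scope classical_set_scope.
Local Open Scope ring_scope.

(* Real Hilbert spaces: complete normed spaces whose norm is induced by an
   inner product. *)
HB.mixin Record NormedModule_isHilbert (R : realType) X
    of NormedModule R X := {
  inner : {dot X for idfun};
  inner_norm : forall x : X, inner x x = `|x| ^+ 2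
}.

#[short(type="hilbertType")]
HB.structure Definition Hilbert (R : realType) :=
  {X of CompleteNormedModule R X & NormedModule_isHilbert R X}.

Section Operators.
Context {R : realType} {X Y : hilbertType R}.
Implicit Types (F A : X -> Y) (x : X).

Definition gateaux F x : X -> Y := fun h => 'D_h F x.

(* The Gateaux derivative is required to be a bounded linear operator; a linear
   map between normed spaces is bounded iff it is continuous. *)
Definition gateaux_differentiable F x : Prop :=
  [/\ forall h, derivable F x h,
      linear (gateaux F x) & continuous (gateaux F x)].

(* Extended real valued: +oo for an unbounded operator. *)
Definition opnorm A : \bar R :=
  ereal_sup [set `|A h|%:E | h in [set h : X | `|h| <= 1]].

(* For a bounded linear A the vector z exists (Riesz) and is unique; 0 is only
   the junk value for other maps A. *)
Definition adjoint A (v : Y) : X :=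
  xget 0 [set z : X | forall h, inner (A h) v = inner h z].

End Operators.

Section PLWK.
Context {R : realType} {X Y : hilbertType R} {N : nat}.
Variable N_gt0 : (0 < N)%N.

Definition cyc (k : nat) : 'I_N := Ordinal (ltn_pmod k N_gt0).

Definition noise_min (delta : 'I_N -> R) : R :=
  \big[Num.min/delta (cyc 0)]_(i < N) delta i.

(* An operator F_i : D(F_i) -> Y is a total function F i together with the set
   D i; its values outside D i are never relevant (see plwk_well_defined). *)
Variables (D : 'I_N -> set X) (F : 'I_N -> X -> Y).
Variables (eta tau : R) (yd : 'I_N -> Y) (delta : 'I_N -> R).
Variables (theta : nat -> R) (x0 : X).

Definition residual (k : nat) (x : X) : Y := F (cyc k) x - yd (cyc k).

Definition gradient (k : nat) (x : X) : X :=
  adjoint (gateaux (F (cyc k)) x) (residual k x).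

Definition pfun (i : 'I_N) (t : R) : R :=
  t * ((1 - eta) * t - (1 + eta) * delta i).

Definition omega (k : nat) (x : X) : R :=
  if tau * delta (cyc k) < `|residual k x| then 1 else 0.

Definition lambda (k : nat) (x : X) : R :=
  if gradient k x == 0 then 0
  else pfun (cyc k) `|residual k x| / `|gradient k x| ^+ 2.

Fixpoint plwk (k : nat) : X :=
  if k is k'.+1 then
    plwk k' -
      (theta k' * lambda k' (plwk k') * omega k' (plwk k')) *:
        gradient k' (plwk k')
  else x0.

(* The update formula makes sense at every step: the iterate is in the domain
   of the active operator, whose Gateaux derivative exists there. *)
Definition plwk_well_defined : Prop :=
  forall k, D (cyc k) (plwk k) /\ gateaux_differentiable (F (cyc k)) (plwk k).

End PLWK.

Section Stopping.
Context {X : Type}.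
Variables (N : nat) (x : nat -> X).

Definition stationary_index (k : nat) : Prop :=
  exists2 l : nat, k = (l * N)%N &
    forall j, (j <= N)%N -> x (l * N + j)%N = x (l * N)%N.

Definition is_stopping_index (k : nat) : Prop :=
  stationary_index k /\ forall m, stationary_index m -> (k <= m)%N.

(* k is at most the stopping index, which is infinite (so that every k
   qualifies) when there is no stationary index. *)
Definition upto_stopping_index (k : nat) : Prop :=
  forall ks, is_stopping_index ks -> (k <= ks)%N.

End Stopping.

(* Main.v *)
Require Import Defs.
From HB Require Import structures.
From mathcomp Require Import all_boot all_order all_algebra.
From mathcomp Require Import all_classical all_reals all_analysis.
From mathcomp Require Import ring lra.

Set Implicit Arguments.
Unset Strict Implicit.
Unset Printing Implicit Defensive.

Import Order.TTheory GRing.Theory Num.Theory.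
Import numFieldNormedType.Exports.

Local Open Scope classical_set_scope.
Local Open Scope ring_scope.

(** The theorem is a Fejer monotonicity argument: every effective step brings
    the iterate closer to the solution [xstar], by a controlled amount.

    Fix a step at a point [x] of the ball around [x0], with residual
    [r = F x - yd], [A = F'(x)] and [g = A^* r].  The tangential cone condition
    compares [A (xstar - x)] with [F xstar - F x], hence with [- r], up to an
    error of norm at most [eta * (|r| + delta)] and a noise term of norm at most
    [delta].  Pairing with [r] gives
    [<g, x - xstar> >= |r| ((1 - eta) |r| - (1 + eta) delta) = p(|r|)]
    ([gradient_error_ge]): the half-space
    [{z | <g, x - z> >= p(|r|)}] contains the solution, and the
    step is a relaxed projection onto it.  When the discrepancy test
    [tau * delta < |r|] is passed, [p(|r|) > 0], so [g <> 0] and [x] is separated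
    from the solution.  Expanding the square with [lambda = p / |g|^2] yields
    [|x' - xstar|^2 <= |x - xstar|^2 - theta (2 - theta) lambda p]
    ([step_error_le]).  Since the error never grows, the iterates stay in the
    ball of radius [rho / 2] around [xstar], where the hypotheses apply again.

    For [theta] in [[a, b]] the factor [theta (2 - theta)] is at least
    [a (2 - b)], so the gains [lambda p] have a finite sum; for exact data the
    terms of both series are bounded by constant multiples of these gains.
    For noisy data, [|g| <= C |r|] and [p(|r|) >= gap * delta * |r|] bound the
    gain of an effective step below by a multiple of [delta^2] ([gain_ge]).  As
    each cycle before the stopping index contains such a step, there are only
    [O(delta_min^-2)] of them.  Relaxation parameters after the stopping index
    are harmless: a stationary cycle means that no equation passes the test, and
    the sequence is constant from then on ([stationary_inactive]).

    The equation [<A h, v> = <h, A^* v>] rests on the Riesz representation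
    theorem, obtained by minimizing [|x|^2 - 2 f x]
    ([riesz_representation]). *)

(** * Inner products and the Riesz representation theorem *)

Lemma discriminant_le0 (R : realFieldType) (a b c : R) :
  0 <= a -> (forall t, 0 <= t ^+ 2 * a + 2 * (t * b) + c) -> b ^+ 2 <= a * c.
Proof.
rewrite le_eqVlt => /orP[/eqP <- q0|a0 q0].
  (* For a = 0 a nonzero slope b would make the value at this t equal to -1. *)
  rewrite mul0r; case: (eqVneq b 0) => [->|b0]; first by rewrite expr0n.
  have := q0 (- (c + 1) / (2 * b)).
  suff -> : (- (c + 1) / (2 * b)) ^+ 2 * 0 + 2 * (- (c + 1) / (2 * b) * b) + c
    = -1 by rewrite ler0N1.
  by field.
have := q0 (- b / a).
have -> : (- b / a) ^+ 2 * a + 2 * (- b / a * b) + c = (a * c - b ^+ 2) / a.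
  by field; rewrite gt_eqF.
by rewrite pmulr_lge0 ?invr_gt0// subr_ge0.
Qed.

Section InnerProduct.
Context {R : realType} {X : hilbertType R}.
Implicit Types x y h : X.

Lemma inner_sym x y : inner x y = inner y x.
Proof. by rewrite hermC expr0 mul1r. Qed.

Lemma inner_addl x h z : inner (x + h) z = inner x z + inner h z.
Proof. by rewrite linearDl. Qed.

Lemma inner_oppl x y : inner (- x) y = - inner x y.
Proof. by rewrite linearNl. Qed.

Lemma inner_addZr z x h (t : R) :
  inner z (x + t *: h) = inner z x + t * inner z h.
Proof. by rewrite linearDr linearZr_LR. Qed.

Lemma normr_addZ_sqr x h (t : R) :
  `|x + t *: h| ^+ 2 = t ^+ 2 * `|h| ^+ 2 + 2 * (t * inner x h) + `|x| ^+ 2.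
Proof.
rewrite -inner_norm inner_addZr !(inner_sym (x + _)) !inner_addZr !inner_norm.
rewrite (inner_sym h x); ring.
Qed.

Lemma inner_CauchySchwarz x y : `|inner x y| <= `|x| * `|y|.
Proof.
rewrite -(ler_pXn2r (n := 2)) ?nnegrE ?mulr_ge0// real_normK ?num_real//.
rewrite exprMn mulrC; apply: discriminant_le0 => [|t]; first exact: exprn_ge0.
by rewrite -normr_addZ_sqr exprn_ge0.
Qed.

End InnerProduct.

(** The representing vector of [f] minimizes [J x = |x|^2 - 2 f x].  The
    parallelogram identity makes points with [J x <= m + e ^ 2] cluster, and
    their gradient is small, so a limit of such points has zero gradient.
    Working with the gradient bound along the sequence avoids passing to the
    limit in [J] itself. *)
Section Riesz.
Context {R : realType} {X : hilbertType R} (f : X -> R) (L : R).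
Hypotheses (f_lin : linear f) (f_bnd : forall h, `|f h| <= L * `|h|).
Let J (x : X) : R := `|x| ^+ 2 - 2 * f x.
Let m : R := inf (range J).

Let f_addZ x (t : R) h : f (x + t *: h) = f x + t * f h.
Proof. by rewrite addrC f_lin addrC. Qed.

Let J_addZ x h (t : R) :
  J (x + t *: h) = t ^+ 2 * `|h| ^+ 2 + 2 * (t * (inner x h - f h)) + J x.
Proof. by rewrite /J normr_addZ_sqr f_addZ; ring. Qed.

(* From f x <= L |x|, this is (|x| - L)^2 >= 0. *)
Let J_lbound : lbound (range J) (- L ^+ 2).
Proof.
move=> _ [x _ <-]; rewrite /J.
have := ler_norm (f x); have := f_bnd x.
by have := sqr_ge0 (`|x| - L); nra.
Qed.

Let J_ge x : m <= J x.
Proof. by apply: ge_inf; [exists (- L ^+ 2)|exists x]. Qed.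

Let near_minimizer (e : R) : 0 < e -> exists x, J x <= m + e ^+ 2.
Proof.
move=> e0; have e20 : 0 < e ^+ 2 by rewrite exprn_gt0.
have [|_ [x _ <-] /ltW Jx] := inf_adherent (E := range J) e20; last by exists x.
by split; [exists (J 0), 0|exists (- L ^+ 2)].
Qed.

(* Evaluating J at the midpoint, where it is at least m, bounds |x - y|^2 by
   2 (e^2 + e'^2). *)
Let near_minimizer_dist x y (e e' : R) : 0 <= e -> 0 <= e' ->
  J x <= m + e ^+ 2 -> J y <= m + e' ^+ 2 -> `|x - y| <= 2 * (e + e').
Proof.
move=> e0 e'0 Jx Jy.
rewrite -(ler_pXn2r (n := 2)) ?nnegrE ?mulr_ge0 ?addr_ge0//.
have yE : y = x + (-1) *: (x - y) by rewrite scaleN1r opprB subrKC.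
move: Jy; rewrite {1}yE J_addZ.
have := J_ge (x + (- 2^-1) *: (x - y)); rewrite J_addZ.
set c := inner _ _ - _; set d := `|_| ^+ 2; move=> h1 h2.
have : 0 <= e * e' by rewrite mulr_ge0.
by move=> ?; nra.
Qed.

(* J (x + t h) - m is a nonnegative quadratic in t with constant term at most
   e^2; the claim is its discriminant inequality. *)
Let near_minimizer_grad x h (e : R) : 0 <= e ->
  J x <= m + e ^+ 2 -> `|inner x h - f h| <= e * `|h|.
Proof.
move=> e0 Jx; rewrite -(ler_pXn2r (n := 2)) ?nnegrE ?mulr_ge0//.
rewrite real_normK ?num_real// exprMn mulrC.
apply: discriminant_le0 => [|t]; first exact: exprn_ge0.
by have := J_ge (x + t *: h); rewrite J_addZ; lra.
Qed.

Lemma riesz_representation : exists z : X, forall h, f h = inner h z.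
Proof.
pose e (n : nat) : R := n.+1%:R^-1.
have e_gt0 n : 0 < e n by rewrite invr_gt0.
have /choice[x Jx] : forall n, exists x, J x <= m + e n ^+ 2.
  by move=> n; exact: near_minimizer.
have e_small (d : R) : 0 < d -> \forall n \near \oo, e n < d.
  by move=> d0; exact: near_infty_natSinv_lt (PosNum d0).
have /cauchy_cvg/cvg_ex[z xz] : cauchy (x @ \oo).
  apply: cauchy_exP => d d0.
  have d40 : 0 < d / 4 by rewrite divr_gt0.
  have [n0 _ n0P] := e_small _ d40.
  exists (x n0), n0 => // n /n0P /= en.
  rewrite -ball_normE /=.
  apply: le_lt_trans (near_minimizer_dist (ltW (e_gt0 _)) (ltW (e_gt0 _))
    (Jx n0) (Jx n)) _.
  by have := n0P n0 (leqnn _); rewrite /=; lra.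
exists z => h; rewrite inner_sym; apply/eqP; rewrite eq_sym -subr_eq0 -normr_le0.
apply/ler_addgt0Pr => d d0; rewrite add0r.
have h0 : 0 < `|h| + 1 by rewrite ltr_wpDl.
have d20 : 0 < d / 2 / (`|h| + 1) by rewrite !divr_gt0.
near \oo => n.
have xn : `|z - x n| <= d / 2 / (`|h| + 1).
  by near: n; move/cvgrPdist_le : xz; apply.
have en : e n <= d / 2 / (`|h| + 1) by apply: ltW; near: n; exact: e_small.
have -> : inner z h - f h = inner (z - x n) h + (inner (x n) h - f h).
  by rewrite inner_addl inner_oppl; ring.
apply: le_trans (ler_normD _ _) _.
apply: le_trans (lerD (inner_CauchySchwarz _ _)
  (near_minimizer_grad _ (ltW (e_gt0 _)) (Jx n))) _.
rewrite -mulrDl.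
apply: (@le_trans _ _ (d / (`|h| + 1) * `|h|)).
  by rewrite ler_wpM2r//; apply: le_trans (lerD xn en) _; lra.
rewrite mulrAC ler_pdivrMr// ler_pM2l//; lra.
Unshelve. all: by end_near. Qed.

End Riesz.

(** * Adjoints of bounded operators *)

Section Adjoint.
Context {R : realType} {X Y : hilbertType R} (A : X -> Y) (C : R).
Hypotheses (A_lin : linear A) (A_bnd : (opnorm A <= C%:E)%E).

Lemma opnorm_bound h : `|A h| <= C * `|h|.
Proof.
have A0 : A 0 = 0.
  by have := A_lin (-1) 0 0; rewrite scaler0 addr0 scaleN1r addNr.
have AZ a u : A (a *: u) = a *: A u by rewrite -[a *: u]addr0 A_lin A0 addr0.
have [->|h0] := eqVneq h 0; first by rewrite A0 !normr0 mulr0.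
have nh : 0 < `|h| by rewrite normr_gt0.
have : (`|A (`|h|^-1 *: h)|%:E <= C%:E)%E.
  apply: le_trans A_bnd; apply: ereal_sup_ubound; exists (`|h|^-1 *: h) => //=.
  by rewrite normrZ normfV normr_id mulVf ?gt_eqF.
by rewrite lee_fin AZ normrZ normfV normr_id ler_pdivrMl// mulrC.
Qed.

Lemma adjointP v h : inner (A h) v = inner h (adjoint A v).
Proof.
suff : exists z, forall h, inner (A h) v = inner h z.
  by rewrite /adjoint; move/(xgetPex 0); apply.
apply: (@riesz_representation _ _ (fun h => inner (A h) v) (C * `|v|)).
  by move=> a u w; rewrite A_lin linearDl linearZl_LR.
move=> u; apply: le_trans (inner_CauchySchwarz _ _) _.
by rewrite mulrAC ler_wpM2r// opnorm_bound.
Qed.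

Lemma adjoint_norm_le v : `|adjoint A v| <= C * `|v|.
Proof.
set g := adjoint A v.
have C0 : 0 <= C.
  apply: le_trans (normr_ge0 (A 0)) _; rewrite -lee_fin.
  by apply: le_trans A_bnd; apply: ereal_sup_ubound; exists 0; rewrite //= normr0.
have [->|g0] := eqVneq g 0; first by rewrite normr0 mulr_ge0.
rewrite -(ler_pM2r (x := `|g|)) ?normr_gt0// -expr2 -inner_norm -adjointP.
apply: le_trans (ler_norm _) _; apply: le_trans (inner_CauchySchwarz _ _) _.
by rewrite mulrAC ler_wpM2r// opnorm_bound.
Qed.

End Adjoint.
(** * One step of the iteration *)

(** The stopping index in the form that counting cycles needs: it is the first
    of the multiples of [N] at which a whole cycle is stationary. *)
Lemma stopping_index_exists (T : Type) (N : nat) (u : nat -> T) l :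
  stationary_index N u (l * N)%N ->
  exists2 l', is_stopping_index N u (l' * N)%N &
    forall m, (m < l')%N -> ~ stationary_index N u (m * N)%N.
Proof.
move=> st; pose P m := `[< stationary_index N u (m * N)%N >].
have exP : exists m, P m by exists l; apply/asboolP.
have [m /asboolP Pm mmin] := ex_minnP exP; exists m.
  split=> // _ [n -> xn]; rewrite leq_mul2r mmin ?orbT//.
  by apply/asboolP; exists n.
by move=> n nm /asboolP /mmin; rewrite leqNgt nm.
Qed.

Section KaczmarzStep.
Context {R : realType} {X Y : hilbertType R} {N : nat} (N_gt0 : (0 < N)%N).
Context (F : 'I_N -> X -> Y) (y : 'I_N -> Y) (x0 xstar : X) (C rho eta tau : R).
Context (yd : 'I_N -> Y) (delta : 'I_N -> R) (theta : nat -> R).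
Hypotheses (F_diff : forall i x, ball x0 rho x -> gateaux_differentiable (F i) x)
  (F_bound : forall i x, ball x0 rho x ->
     (opnorm (gateaux (F i) x) <= C%:E)%E)
  (eta_lt1 : eta < 1)
  (F_cone : forall i x xbar, ball x0 rho x -> ball x0 rho xbar ->
     `|F i xbar - F i x - gateaux (F i) x (xbar - x)|
       <= eta * `|F i xbar - F i x|)
  (xstar_ball : ball x0 (rho / 2) xstar)
  (xstar_sol : forall i, F i xstar = y i)
  (tau_gt1 : 1 < tau) (tau_gt : (1 + eta) * (1 - eta)^-1 < tau)
  (noise : forall i, `|yd i - y i| <= delta i)
  (theta02 : forall k, 0 < theta k < 2).

Local Notation r := (residual N_gt0 F yd).
Local Notation g := (gradient N_gt0 F yd).
Local Notation p := (pfun eta delta).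
Local Notation w := (omega N_gt0 F tau yd delta).
Local Notation lam := (lambda N_gt0 F eta yd delta).
Local Notation x_ := (plwk N_gt0 F eta tau yd delta theta x0).
Local Notation active k x := (tau * delta (cyc N_gt0 k) < `|r k x|).

(** Positive exactly because of the lower bound imposed on [tau]; it measures by
    how much a residual passing the discrepancy test makes [p] positive. *)
Definition discrepancy_gap : R := (1 - eta) * tau - (1 + eta).

(** The squared distance from [x] to the hyperplane onto which the step projects
    (zero when the test fails): it is the decrease of the squared error that a
    full projection guarantees. *)
Definition gain (k : nat) (x : X) : R :=
  w k x * (lam k x * p (cyc N_gt0 k) `|r k x|).

Lemma discrepancy_gap_gt0 : 0 < discrepancy_gap.
Proof.
by rewrite /discrepancy_gap subr_gt0 mulrC -ltr_pdivrMr ?subr_gt0.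
Qed.

Lemma noise_level_ge0 i : 0 <= delta i.
Proof. exact: le_trans (noise i). Qed.

Lemma half_ball_sub : ball xstar (rho / 2) `<=` ball x0 rho.
Proof. by move=> x /(ball_triangle xstar_ball); rewrite -splitr. Qed.

Lemma xstar_in_ball : ball x0 rho xstar.
Proof.
apply: half_ball_sub; apply: ballxx.
by move: xstar_ball; rewrite -ball_normE /=; apply: le_lt_trans.
Qed.

Lemma omega_active k x : active k x -> w k x = 1.
Proof. by rewrite /omega => ->. Qed.

Lemma omega_inactive k x : ~ active k x -> w k x = 0.
Proof. by rewrite /omega => /negP/negbTE ->. Qed.

Lemma active_residual_gt0 k x : active k x -> 0 < `|r k x|.
Proof.
by apply: le_lt_trans; rewrite mulr_ge0 ?noise_level_ge0// ltW// (lt_trans ltr01).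
Qed.

Lemma pfun_ge k x : active k x ->
  discrepancy_gap * delta (cyc N_gt0 k) * `|r k x| <= p (cyc N_gt0 k) `|r k x|.
Proof.
move=> act; rewrite /pfun mulrC ler_wpM2l// /discrepancy_gap.
have : 0 <= (1 - eta) * (`|r k x| - tau * delta (cyc N_gt0 k)).
  by rewrite mulr_ge0 ?subr_ge0// ltW.
lra.
Qed.

Lemma pfun_gt0 k x : active k x -> 0 < p (cyc N_gt0 k) `|r k x|.
Proof.
move=> act; rewrite /pfun mulr_gt0 ?active_residual_gt0//.
have : 0 < (1 - eta) * (`|r k x| - tau * delta (cyc N_gt0 k)).
  by rewrite mulr_gt0 ?subr_gt0.
have := mulr_ge0 (ltW discrepancy_gap_gt0) (noise_level_ge0 (cyc N_gt0 k)).
rewrite /discrepancy_gap; lra.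
Qed.

(** A negative [eta] forces each [F i] to be constant on the ball, so residuals
    are pure noise and cannot pass the test. *)
Lemma active_cone_ge0 k x : ball x0 rho x -> active k x -> 0 <= eta.
Proof.
move=> xb act; rewrite leNgt; apply/negP => eta0.
have := le_trans (normr_ge0 _) (F_cone (cyc N_gt0 k) xb xstar_in_ball).
rewrite nmulr_rge0// normr_le0 subr_eq0 xstar_sol => /eqP yE.
have := noise (cyc N_gt0 k); rewrite yE -normrN opprB => rd.
have := lt_le_trans act rd; have := noise_level_ge0 (cyc N_gt0 k).
by move: tau_gt1; nra.
Qed.

(** The separation inequality.  With [c] the linearization error in the cone
    condition, [A (xstar - x) = - (r + (yd - y) + c)]; pairing with [r] and
    bounding the last two terms by Cauchy-Schwarz gives [p]. *)
Lemma gradient_error_ge k x : ball x0 rho x -> active k x ->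
  p (cyc N_gt0 k) `|r k x| <= inner (x - xstar) (g k x).
Proof.
move=> xb act; have eta0 := active_cone_ge0 xb act.
set i := cyc N_gt0 k.
have [_ A_lin _] := F_diff i xb.
have cone := F_cone i xb xstar_in_ball; rewrite xstar_sol in cone.
rewrite -[x - xstar]opprB inner_oppl -(adjointP A_lin (F_bound i xb)).
move: cone; set Ae := gateaux _ _ _; set c := y i - _ - Ae => cone.
have AeE : Ae = - (r k x + (yd i - y i) + c).
  rewrite /c /residual -/i.
  by rewrite subrKA addrA subrKA subrr sub0r opprK.
rewrite AeE inner_oppl opprK 2!inner_addl inner_norm.
have dist_noise : `|y i - F i x| <= `|r k x| + delta i.
  rewrite distrC -(subrKA (yd i)); apply: le_trans (ler_normD _ _) _.
  by rewrite lerD2l.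
have cr := inner_CauchySchwarz c (r k x).
have dr := inner_CauchySchwarz (yd i - y i) (r k x).
have := ler_norm (- inner c (r k x)).
have := ler_norm (- inner (yd i - y i) (r k x)).
rewrite !normrN.
have dr' : `|yd i - y i| * `|r k x| <= delta i * `|r k x| by rewrite ler_wpM2r.
have cr' : `|c| * `|r k x| <= eta * (`|r k x| + delta i) * `|r k x|.
  by rewrite ler_wpM2r// (le_trans cone)// ler_wpM2l.
rewrite /pfun; lra.
Qed.

Lemma gradient_neq0 k x : ball x0 rho x -> active k x -> g k x != 0.
Proof.
move=> xb act; apply/eqP => g0; have := gradient_error_ge xb act.
by rewrite g0 linear0r leNgt pfun_gt0.
Qed.

Lemma lambda_gradient k x : ball x0 rho x -> active k x ->
  lam k x * `|g k x| ^+ 2 = p (cyc N_gt0 k) `|r k x|.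
Proof.
move=> xb act; have g0 := gradient_neq0 xb act.
by rewrite /lambda (negbTE g0) divfK// expf_neq0// normr_eq0.
Qed.

Lemma lambda_gt0 k x : ball x0 rho x -> active k x -> 0 < lam k x.
Proof.
move=> xb act; have g0 := gradient_neq0 xb act.
by rewrite /lambda (negbTE g0) divr_gt0 ?pfun_gt0// exprn_gt0// normr_gt0.
Qed.

Lemma gain_ge0 k x : ball x0 rho x -> 0 <= gain k x.
Proof.
move=> xb; rewrite /gain; have [act|inact] := pselect (active k x).
  by rewrite omega_active// mul1r mulr_ge0// ltW ?lambda_gt0 ?pfun_gt0.
by rewrite omega_inactive// mul0r.
Qed.

(** Where the rate comes from: the gain is [(p / |g|)^2], while
    [p >= gap * delta * |r|] and [|g| <= C |r|], so the residual cancels. *)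
Lemma gain_ge k x : ball x0 rho x -> active k x ->
  (discrepancy_gap * delta (cyc N_gt0 k) / C) ^+ 2 <= gain k x.
Proof.
move=> xb act; have [_ A_lin _] := F_diff (cyc N_gt0 k) xb.
have g0 : 0 < `|g k x| by rewrite normr_gt0 gradient_neq0.
have gC : `|g k x| <= C * `|r k x|.
  exact: adjoint_norm_le A_lin (F_bound _ xb) _.
have r0 := active_residual_gt0 act.
have C0 : 0 < C by rewrite -(pmulr_lgt0 _ r0) (lt_le_trans g0).
rewrite /gain omega_active// mul1r /lambda -normr_eq0 (gt_eqF g0) /=.
rewrite [leRHS]mulrAC -expr2 -expr_div_n ler_pXn2r ?nnegrE.
- rewrite ler_pdivrMr// mulrAC ler_pdivlMr//.
  have gd0 : 0 <= discrepancy_gap * delta (cyc N_gt0 k).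
    by rewrite mulr_ge0 ?noise_level_ge0// ltW ?discrepancy_gap_gt0.
  apply: le_trans (ler_wpM2l gd0 gC) _.
  by rewrite mulrCA mulrC ler_wpM2r ?pfun_ge// ltW.
- by [].
- by rewrite !mulr_ge0 ?invr_ge0 ?noise_level_ge0// ltW ?discrepancy_gap_gt0.
- by rewrite divr_ge0// ltW ?pfun_gt0.
Qed.

Section Step.
Variable k : nat.
Hypothesis xk_ball : ball x0 rho (x_ k).

Lemma step_inactive : ~ active k (x_ k) -> x_ k.+1 = x_ k.
Proof. by move=> inact /=; rewrite omega_inactive// mulr0 scale0r subr0. Qed.

(** The separation inequality excludes a zero gradient once the test is passed,
    so a vanishing step always means that the discrepancy test fails. *)
Lemma step_active : active k (x_ k) -> x_ k.+1 != x_ k.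
Proof.
move=> act /=; rewrite -subr_eq0 addrAC subrr add0r oppr_eq0 scaler_eq0.
rewrite (negbTE (gradient_neq0 xk_ball act)) orbF omega_active// mulr1.
by have /andP[t0 _] := theta02 k; rewrite mulf_neq0// gt_eqF// lambda_gt0.
Qed.

Lemma step_norm_sqr :
  `|x_ k.+1 - x_ k| ^+ 2 = theta k ^+ 2 * gain k (x_ k).
Proof.
have [act|inact] := pselect (active k (x_ k)); last first.
  rewrite step_inactive// subrr normr0 /gain omega_inactive//.
  by rewrite mul0r mulr0 expr0n.
rewrite /= addrAC subrr add0r normrN normrZ exprMn real_normK ?num_real//.
rewrite /gain -lambda_gradient// omega_active//; ring.
Qed.

(** Expanding the square gives
    [- 2 theta lambda <g, x - xstar> + theta^2 lambda^2 |g|^2]; by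
    [lambda |g|^2 = p] and [<g, x - xstar> >= p] this is at most
    [- theta (2 - theta) lambda p]. *)
Lemma step_error_le :
  `|x_ k.+1 - xstar| ^+ 2 <=
    `|x_ k - xstar| ^+ 2 - theta k * (2 - theta k) * gain k (x_ k).
Proof.
have [act|inact] := pselect (active k (x_ k)); last first.
  by rewrite step_inactive// /gain omega_inactive// mul0r mulr0 subr0.
have /andP[t0 _] := theta02 k.
rewrite /= addrAC -scaleNr normr_addZ_sqr /gain omega_active// mulr1 mul1r.
have lamg := lambda_gradient xk_ball act.
have : 0 <= theta k * lam k (x_ k) *
    (inner (x_ k - xstar) (g k (x_ k)) - p (cyc N_gt0 k) `|r k (x_ k)|).
  rewrite mulr_ge0 ?subr_ge0 ?gradient_error_ge// mulr_ge0// ltW//.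
  exact: lambda_gt0.
rewrite -lamg; lra.
Qed.

End Step.


(** * Monotonicity of the error and stationarity *)

Lemma theta_weight_ge0 k : 0 <= theta k * (2 - theta k).
Proof.
by have /andP[t0 t2] := theta02 k; rewrite mulr_ge0 ?subr_ge0// ltW.
Qed.

Lemma plwk_half_ball k : ball xstar (rho / 2) (x_ k).
Proof.
elim: k => [|k IHk]; first exact: ball_sym.
have xb := half_ball_sub IHk.
move: IHk; rewrite -!ball_normE /=; apply: le_lt_trans.
rewrite distrC (distrC xstar) -(ler_pXn2r (n := 2)) ?nnegrE//.
apply: le_trans (step_error_le xb) _.
by rewrite gerBl mulr_ge0 ?theta_weight_ge0 ?gain_ge0.
Qed.

Lemma plwk_ball k : ball x0 rho (x_ k).
Proof. exact/half_ball_sub/plwk_half_ball. Qed.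

Local Notation err k := (`|x_ k - xstar| ^+ 2).

Lemma err0_le : err 0 <= (rho / 2) ^+ 2.
Proof.
move: xstar_ball; rewrite -ball_normE /= => /ltW xs.
by rewrite ler_pXn2r ?nnegrE ?(le_trans _ xs).
Qed.

Lemma err_nonincreasing m n : (m <= n)%N -> err n <= err m.
Proof.
apply: (nonincreasing_seqP (fun k => err k)).1 => k.
apply: le_trans (step_error_le (plwk_ball k)) _.
by rewrite gerBl mulr_ge0 ?theta_weight_ge0 ?gain_ge0//; exact: plwk_ball.
Qed.

Lemma plwk_constant n j :
  (forall i, (i < j)%N -> ~ active (n + i)%N (x_ (n + i)%N)) ->
  forall i, (i <= j)%N -> x_ (n + i)%N = x_ n.
Proof.
move=> inact; elim=> [|i IHi] ij; first by rewrite addn0.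
rewrite addnS -(IHi (ltnW ij)); apply: step_inactive; exact: inact.
Qed.

Lemma active_cyc k m x : cyc N_gt0 k = cyc N_gt0 m -> active k x -> active m x.
Proof. by rewrite /residual => ->. Qed.

(** A stationary cycle visits all [N] equations at the same point, and none of
    them moves it; by periodicity nothing moves it later either. *)
Lemma stationary_inactive ks : stationary_index N x_ ks ->
  forall k, (ks <= k)%N -> ~ active k (x_ k).
Proof.
move=> [l -> xl].
have z_inact k : ~ active k (x_ (l * N)%N).
  move=> act; have kN : (k %% N < N)%N by rewrite ltn_pmod.
  have : active (l * N + k %% N)%N (x_ (l * N)%N).
    apply: active_cyc act; apply: val_inj => /=.
    by rewrite modnMDl modn_mod.
  rewrite -(xl _ (ltnW kN)) => /(step_active (plwk_ball _)) /eqP; apply.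
  by rewrite -addnS; apply: etrans (xl _ kN) (esym (xl _ (ltnW kN))).
have xz i : x_ (l * N + i)%N = x_ (l * N)%N.
  elim: i => [|i IHi]; first by rewrite addn0.
  by rewrite addnS; apply: (etrans (step_inactive _) IHi); rewrite IHi.
by move=> k /subnKC <-; rewrite xz.
Qed.

(** * Summability and length of the iteration *)

Section RelaxationBounds.
Context (a b : R).
Hypotheses (a_gt0 : 0 < a) (b_lt2 : b < 2)
  (thetaab : forall k, upto_stopping_index N x_ k -> a <= theta k <= b).

(** The bounds on [theta] are known only up to the stopping index, but beyond it
    [theta] no longer influences the iteration. *)
Lemma bounds_or_inactive k : a <= theta k <= b \/ ~ active k (x_ k).
Proof.
have [up|] := pselect (upto_stopping_index N x_ k); first by left; exact: thetaab.
move/existsNP=> [ks /not_implyP[[st _] /negP]]; rewrite -ltnNge => /ltnW ksk.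
by right; exact: stationary_inactive st _ ksk.
Qed.

Lemma err_decrease k :
  err k.+1 <= err k - a * (2 - b) * gain k (x_ k).
Proof.
have xb := plwk_ball k.
have [/andP[ta tb]|inact] := bounds_or_inactive k; last first.
  by rewrite step_inactive// /gain omega_inactive// mul0r mulr0 subr0.
apply: le_trans (step_error_le xb) _.
rewrite lerD2l lerN2 ler_wpM2r ?gain_ge0// ler_pM ?lerD2l ?lerN2 ?subr_ge0//.
all: exact: ltW.
Qed.

Lemma sum_gain_le n :
  a * (2 - b) * \sum_(0 <= k < n) gain k (x_ k) <= err 0 - err n.
Proof.
elim: n => [|n IHn]; first by rewrite big_nil mulr0 subrr.
rewrite big_nat_recr//= mulrDr.
by have := err_decrease n; lra.
Qed.

Lemma gain_summable : cvgn (series (fun k => gain k (x_ k))).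
Proof.
have ab0 : 0 < a * (2 - b) by rewrite mulr_gt0 ?subr_gt0.
apply: nondecreasing_is_cvgn.
  by apply: nondecreasing_series => k _ _; exact/gain_ge0/plwk_ball.
exists (err 0 / (a * (2 - b))) => _ [n _ <-].
rewrite ler_pdivlMr// mulrC (le_trans (sum_gain_le n))//.
by rewrite gerBl exprn_ge0.
Qed.

(** Since [theta <= 2], each squared increment is at most four gains. *)
Lemma increments_summable : cvgn (series (fun k => `|x_ k.+1 - x_ k| ^+ 2)).
Proof.
have /(is_cvg_seriesZ (k := 4 : R)) := gain_summable.
apply: series_le_cvg => k; first exact: exprn_ge0.
  by rewrite mulr_ge0 ?gain_ge0//; exact: plwk_ball.
have xb := plwk_ball k; rewrite (step_norm_sqr xb) ler_wpM2r ?gain_ge0//.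
by have /andP[t0 t2] := theta02 k; nra.
Qed.

Lemma active_err_drop (d : R) k : (forall i, d <= delta i) -> 0 <= d ->
  active k (x_ k) ->
  err k.+1 <= err k - a * (2 - b) * (discrepancy_gap * d / C) ^+ 2.
Proof.
move=> dd d0 act; apply: le_trans (err_decrease k) _.
have ab0 : 0 < a * (2 - b) by rewrite mulr_gt0 ?subr_gt0.
rewrite lerD2l lerN2 ler_pM2l//; apply: le_trans (gain_ge (plwk_ball k) act).
rewrite !exprMn ler_wpM2r ?sqr_ge0// ler_wpM2l ?sqr_ge0//.
by rewrite ler_pXn2r ?nnegrE ?noise_level_ge0.
Qed.

(** A cycle that is not stationary contains an effective step; the other steps
    of the cycle do not increase the error. *)
Lemma cycle_err_drop (d : R) l : (forall i, d <= delta i) -> 0 <= d ->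
  ~ stationary_index N x_ (l * N)%N ->
  err (l.+1 * N)%N <=
    err (l * N)%N - a * (2 - b) * (discrepancy_gap * d / C) ^+ 2.
Proof.
move=> dd d0 nst.
have [[j jN act]|none] := pselect (exists2 j, (j < N)%N &
    active (l * N + j)%N (x_ (l * N + j)%N)).
  apply: (@le_trans _ _ (err (l * N + j).+1)).
    by apply: err_nonincreasing; rewrite mulSnr -addnS leq_add2l.
  apply: le_trans (active_err_drop dd d0 act) _.
  by rewrite lerD2r err_nonincreasing// leq_addr.
case: nst; exists l => // j jN; apply: plwk_constant jN => i iN act.
by apply: none; exists i.
Qed.

Lemma err_cycles (d : R) l : (forall i, d <= delta i) -> 0 <= d ->
  (forall m, (m < l)%N -> ~ stationary_index N x_ (m * N)%N) ->
  l%:R * (a * (2 - b) * (discrepancy_gap * d / C) ^+ 2) <= (rho / 2) ^+ 2.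
Proof.
move=> dd d0 nst; apply: le_trans err0_le.
suff : err (l * N)%N <=
    err 0 - l%:R * (a * (2 - b) * (discrepancy_gap * d / C) ^+ 2).
  by move/(le_trans (exprn_ge0 _ (normr_ge0 _))); rewrite subr_ge0.
elim: l nst => [|l IHl] nst; first by rewrite mul0n mul0r subr0.
apply: le_trans (cycle_err_drop dd d0 (nst l (ltnSn l))) _.
have := IHl (fun m ml => nst m (ltnW ml)).
rewrite -natr1; lra.
Qed.

(** If no cycle were stationary the error would eventually be negative; so the
    iteration stops, and the number of cycles before that is at most the initial
    squared error divided by the drop per cycle. *)
Lemma stopping_index_bound (d : R) : (forall i, d <= delta i) -> 0 < d -> 0 < C ->
  exists2 ks, is_stopping_index N x_ ks &
    ks%:R <= N%:R * (rho / 2) ^+ 2 * C ^+ 2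
      / (a * (2 - b) * discrepancy_gap ^+ 2) * d ^- 2.
Proof.
move=> dd d0 C0; have gap0 := discrepancy_gap_gt0.
have b20 : 0 < 2 - b by rewrite subr_gt0.
set c := a * (2 - b) * (discrepancy_gap * d / C) ^+ 2.
have c0 : 0 < c.
  by apply: mulr_gt0; [exact: mulr_gt0|apply/exprn_gt0/divr_gt0/C0/mulr_gt0].
have [l st] : exists l, stationary_index N x_ (l * N)%N.
  apply: contrapT => /forallNP nst.
  have := archi_boundP (divr_ge0 (sqr_ge0 (rho / 2)) (ltW c0)).
  by rewrite ltr_pdivrMr// ltNge err_cycles// ltW.
have [m stop nst] := stopping_index_exists st; exists (m * N)%N => //.
have := err_cycles dd (ltW d0) nst; rewrite -/c -ler_pdivlMr// => mle.
rewrite natrM mulrC (le_trans (ler_wpM2l (ler0n _ N) mle))//.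
rewrite le_eqVlt; apply/orP; left; apply/eqP; rewrite /c; field.
by rewrite !gt_eqF.
Qed.

End RelaxationBounds.

End KaczmarzStep.

(** Without noise [p t = (1 - eta) t^2], and the test fails only for a zero
    residual. *)
Lemma lambda_residual_exact (R : realType) (X Y : hilbertType R) (N : nat)
    (N_gt0 : (0 < N)%N) (F : 'I_N -> X -> Y) (eta tau : R) (y : 'I_N -> Y) k x :
  eta < 1 ->
  lambda N_gt0 F eta y (fun=> 0) k x
      * `|F (cyc N_gt0 k) x - y (cyc N_gt0 k)| ^+ 2
    = (1 - eta)^-1 * gain N_gt0 F eta tau y (fun=> 0) k x.
Proof.
move=> eta_lt1; rewrite /gain /omega mulr0 /residual normr_gt0 /pfun mulr0 subr0.
case: eqVneq => [->|_] /=; first by rewrite normr0 expr0n mul0r !mulr0.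
by field; rewrite subr_eq0 gt_eqF.
Qed.

Theorem theorem3p5 (R : realType) (X Y : hilbertType R)
    (N : nat) (N_gt0 : (0 < N)%N)
    (D : 'I_N -> set X) (F : 'I_N -> X -> Y) (y : 'I_N -> Y)
    (x0 xstar : X) (C rho eta tau : R)
    (* regularity of the operators *)
    (F_cont : forall i, {within D i, continuous (F i)})
    (D_int : (\bigcap_i D i)° !=set0)
    (D_x0 : (\bigcap_i D i) x0)
    (C_gt0 : 0 < C) (rho_gt0 : 0 < rho)
    (ball_D : ball x0 rho `<=` \bigcap_i D i)
    (F_diff : forall i x, ball x0 rho x -> gateaux_differentiable (F i) x)
    (F_bound : forall i x, ball x0 rho x ->
       (opnorm (gateaux (F i) x) <= C%:E)%E)
    (* local tangential cone condition *)
    (eta_lt1 : eta < 1)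
    (F_cone : forall i x xbar, ball x0 rho x -> ball x0 rho xbar ->
       `|F i xbar - F i x - gateaux (F i) x (xbar - x)|
         <= eta * `|F i xbar - F i x|)
    (* exact solution *)
    (xstar_ball : ball x0 (rho / 2) xstar)
    (xstar_sol : forall i, F i xstar = y i)
    (tau_gt1 : 1 < tau) (tau_gt : (1 + eta) * (1 - eta)^-1 < tau) :
  [/\ (* noisy data: well-definedness and localization *)
      forall (yd : 'I_N -> Y) (delta : 'I_N -> R) (theta : nat -> R),
        (forall i, `|yd i - y i| <= delta i) ->
        (forall k, 0 < theta k < 2) ->
        let x := plwk N_gt0 F eta tau yd delta theta x0 in
        [/\ plwk_well_defined N_gt0 D F eta tau yd delta theta x0,
            ball xstar (rho / 2) `<=` ball x0 rho &
            forall k, upto_stopping_index N x k -> ball xstar (rho / 2) (x k)],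
      (* noisy data: k_* = O(delta_min^-2), the constant being independent of
         the data, the noise levels and the relaxation parameters *)
      forall a b : R, 0 < a -> a <= b -> b < 2 ->
        exists M : R,
        forall (yd : 'I_N -> Y) (delta : 'I_N -> R) (theta : nat -> R),
          (forall i, `|yd i - y i| <= delta i) ->
          0 < noise_min N_gt0 delta ->
          (forall k, 0 < theta k < 2) ->
          let x := plwk N_gt0 F eta tau yd delta theta x0 in
          (forall k, upto_stopping_index N x k -> a <= theta k <= b) ->
          exists2 ks, is_stopping_index N x ks &
            ks%:R <= M * noise_min N_gt0 delta ^- 2
    & (* exact data *)
      forall theta : nat -> R,
        (forall k, 0 < theta k < 2) ->
        let x := plwk N_gt0 F eta tau y (fun=> 0) theta x0 in
        [/\ plwk_well_defined N_gt0 D F eta tau y (fun=> 0) theta x0,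
            ball xstar (rho / 2) `<=` ball x0 rho,
            forall k, ball xstar (rho / 2) (x k) &
            forall a b : R, 0 < a -> a <= b -> b < 2 ->
              (forall k, upto_stopping_index N x k -> a <= theta k <= b) ->
              cvgn (series (fun k => lambda N_gt0 F eta y (fun=> 0) k (x k)
                     * `|F (cyc N_gt0 k) (x k) - y (cyc N_gt0 k)| ^+ 2)) /\
              cvgn (series (fun k => `|x k.+1 - x k| ^+ 2))]].
Proof.
have half_sub := half_ball_sub xstar_ball.
split.
- move=> yd delta theta noise theta02 /=; split=> //.
    move=> k.
    have xb := plwk_ball N_gt0 F_diff F_bound eta_lt1 F_cone xstar_ball xstar_sol
      tau_gt1 tau_gt noise theta02 k.
    by split; [exact: ball_D|exact: F_diff].
  move=> k _; exact: (plwk_half_ball N_gt0 F_diff F_bound eta_lt1 F_cone).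
- move=> a b a0 _ b2.
  exists (N%:R * (rho / 2) ^+ 2 * C ^+ 2
      / (a * (2 - b) * discrepancy_gap eta tau ^+ 2)).
  move=> yd delta theta noise d0 theta02 /= thetaab.
  have dmin i : noise_min N_gt0 delta <= delta i by exact: bigmin_le.
  exact: (stopping_index_bound F_diff F_bound eta_lt1 F_cone xstar_ball
    xstar_sol tau_gt1 tau_gt noise theta02 a0 b2 thetaab dmin d0 C_gt0).
- move=> theta theta02 /=.
  have noise0 i : `|y i - y i| <= 0 by rewrite subrr normr0.
  split=> //.
  + move=> k.
    have xb := plwk_ball N_gt0 F_diff F_bound eta_lt1 F_cone xstar_ball xstar_sol
      tau_gt1 tau_gt noise0 theta02 k.
    by split; [exact: ball_D|exact: F_diff].
  + exact: (plwk_half_ball N_gt0 F_diff F_bound eta_lt1 F_cone).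
  move=> a b a0 _ b2 thetaab.
  split; last exact: (increments_summable F_diff F_bound eta_lt1 F_cone
    xstar_ball xstar_sol tau_gt1 tau_gt noise0 theta02 a0 b2 thetaab).
  under eq_fun do rewrite (@lambda_residual_exact _ _ _ _ N_gt0 F eta tau)//.
  apply: (is_cvg_seriesZ (k := (1 - eta)^-1)).
  exact: (gain_summable F_diff F_bound eta_lt1 F_cone xstar_ball xstar_sol
    tau_gt1 tau_gt noise0 theta02 a0 b2 thetaab).
Qed.
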